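(* Let $q,\beta>0$ and $n\in\mathbb{N}$. Let $r\in\mathbb{N}$ and weights $w_1,\dots,w_r\ge0$ with $\sum_{j=1}^r w_j=1$ be given. For every $f\in C_B(\mathbb{R})\cup C_U(\mathbb{R})$, $$\omega(\overline{B_n}(f),\theta)\le\omega(f,\theta)\quad\text{for all }\theta>0.$$ Furthermore, if $f\in C_U(\mathbb{R})$ then $\overline{B_n}(f)\in C_U(\mathbb{R})$.
   Context: $\mathbb{N}=\{1,2,\dots\}$. For $q,\beta>0$ and $x\in\mathbb{R}$ let $\nu_{q}(x)=\frac{1-qe^{-\beta x}}{1+qe^{-\beta x}}$ and $G_{q,\beta}(x)=\frac14\left(\nu_{q}(x+1)-\nu_{q}(x-1)\right)$; $G_{1/q,\beta}$ is the same with $q$ replaced by $1/q$. Let $\Psi=\frac12\left(G_{q,\beta}+G_{1/q,\beta}\right)$ (an even probability density on $\mathbb{R}$). $C_B(\mathbb{R})$ is the set of continuous bounded real functions on $\mathbb{R}$; $C_U(\mathbb{R})$ is the set of uniformly continuous (not necessarily bounded) real functions on $\mathbb{R}$. For $\theta>0$, $\omega(f,\theta)=\sup\{|f(x)-f(y)|: x,y\in\mathbb{R},\ |x-y|\le\theta\}$. The (quadrature type) operator $\overline{B_n}$ is $$\overline{B_n}(f)(x)=\int_{-\infty}^{\infty}\left(\sum_{j=1}^r w_j f\left(\frac vn+\frac{j}{nr}\right)\right)\Psi(nx-v)\,dv .$$ *)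

(* Defs.v *)
From HB Require Import structures.
From mathcomp Require Import all_boot all_order all_algebra.
From mathcomp Require Import all_classical all_reals all_analysis.
Set Implicit Arguments.
Unset Strict Implicit.
Unset Printing Implicit Defensive.
Import Order.TTheory GRing.Theory Num.Theory.
Import numFieldNormedType.Exports.
Local Open Scope classical_set_scope.
Local Open Scope ring_scope.

Definition nu {R : realType} (q beta x : R) : R :=
  (1 - q * expR (- beta * x)) / (1 + q * expR (- beta * x)).

Definition G {R : realType} (q beta x : R) : R :=
  4^-1 * (nu q beta (x + 1) - nu q beta (x - 1)).

Definition Psi {R : realType} (q beta x : R) : R :=
  2^-1 * (G q beta x + G q^-1 beta x).

Definition C_B {R : realType} : set (R -> R) :=
  [set f | continuous f /\ bounded_fun f].

Definition C_U {R : realType} : set (R -> R) :=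
  [set f | unif_continuous f].

(* The supremum is taken in the extended reals, so that it is meaningful
   without a finiteness assumption on f. *)
Definition omega {R : realType} (f : R -> R) (theta : R) : \bar R :=
  ereal_sup [set (`|f p.1 - f p.2|)%:E | p in
             [set p : R * R | `|p.1 - p.2| <= theta]].

(* The weight w_j, 1 <= j <= r, is w i for the ordinal i with i.+1 = j.
   The Lebesgue integral agrees with the improper one here: Psi decays
   exponentially, while a function in C_B or C_U grows at most linearly. *)
Definition Bbar {R : realType} (q beta : R) (n r : nat) (w : 'I_r -> R)
    (f : R -> R) (x : R) : R :=
  \int[@lebesgue_measure R]_v
    ((\sum_(i < r) w i * f (v / n%:R + i.+1%:R / (n * r)%:R))
       * Psi q beta (n%:R * x - v)).

(* Main.v *)
Require Import Defs.
From HB Require Import structures.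
From mathcomp Require Import all_boot all_order all_algebra.
From mathcomp Require Import all_classical all_reals all_analysis.
From mathcomp Require Import measurable_realfun ring lra.
Import Order.TTheory GRing.Theory Num.Theory.
Import numFieldNormedType.Exports.
Local Open Scope classical_set_scope.
Local Open Scope ring_scope.

(** Reflecting [v = n x - u] turns [Bbar f x] into the average, against the
    density [Psi u], of the weighted means of the values
    [f (x - u / n + j / (n r))]; hence [Bbar f x - Bbar f y] is an average of
    increments of [f] over distance [|x - y|].  The splitting of the difference
    needs [f * Psi] to be integrable: [f] grows at most linearly and [Psi]
    decays exponentially.  The total mass of [Psi] comes from its primitive and
    its evenness. *)

(** * The kernel [Psi]: evenness, exponential decay, primitive and continuity *)

Section kernel.
Context {R : realType}.
Implicit Types q beta c x : R.
Notation mu := (@lebesgue_measure R).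

Lemma logistic_den_gt0 q beta x : 0 < q -> 0 < 1 + q * expR (- beta * x).
Proof. by move=> q0; rewrite addr_gt0// mulr_gt0// expR_gt0. Qed.

(** The exponential now occurs once, in a positive denominator, so monotonicity, bounds and
    derivatives reduce to that denominator. *)
Lemma nuE q beta x : 0 < q ->
  nu q beta x = 2 * (1 + q * expR (- beta * x))^-1 - 1.
Proof.
move=> q0; have := logistic_den_gt0 q beta x q0; rewrite /nu => /lt0r_neq0 ?.
by field.
Qed.

Lemma nu_nondecreasing q beta x y : 0 < q -> 0 < beta -> x <= y ->
  nu q beta x <= nu q beta y.
Proof.
move=> q0 b0 xy; rewrite !nuE// lerD2r ler_pM2l// lef_pV2 ?posrE ?logistic_den_gt0//.
by rewrite lerD2l ler_pM2l// ler_expR !mulNr lerN2 ler_pM2l.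
Qed.

(** Multiply numerator and denominator by [q^-1 * expR (- beta * x)]. This exchange of [q] and
    [q^-1] is why averaging the two [G] makes [Psi] even. *)
Lemma nuN q beta x : 0 < q -> nu q beta (- x) = - nu q^-1 beta x.
Proof.
move=> q0; rewrite /nu mulrN -mulNr opprK.
have -> : expR (- beta * x) = (expR (beta * x))^-1 by rewrite mulNr expRN.
have e0 := expR_gt0 (beta * x).
field; rewrite !lt0r_neq0 ?addr_gt0 ?mulr_gt0//.
Qed.

Lemma G_ge0 q beta x : 0 < q -> 0 < beta -> 0 <= G q beta x.
Proof.
by move=> q0 b0; rewrite /G mulr_ge0// subr_ge0 nu_nondecreasing//; lra.
Qed.

Lemma GN q beta x : 0 < q -> G q beta (- x) = G q^-1 beta x.
Proof.
move=> q0; rewrite /G.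
have -> : - x + 1 = - (x - 1) by ring.
have -> : - x - 1 = - (x + 1) by ring.
by rewrite !nuN//; ring.
Qed.

(** With [a = q * expR (- beta * (x - 1))], one reciprocal is at most 1 and
    [1 - (1 + a)^-1 = a / (1 + a) <= a]. The bound shows decay only at [+oo]; evenness of [Psi]
    covers the other side. *)
Lemma G_le_expR q beta x : 0 < q -> 0 < beta ->
  G q beta x <= q * expR beta * expR (- beta * x).
Proof.
move=> q0 b0; rewrite /G !nuE//.
have := logistic_den_gt0 q beta (x + 1) q0; have := logistic_den_gt0 q beta (x - 1) q0.
have -> : q * expR beta * expR (- beta * x) = q * expR (- beta * (x - 1)).
  by rewrite -mulrA -expRD; congr (_ * expR _); ring.
have : 1 <= 1 + q * expR (- beta * (x + 1)) by rewrite lerDl mulr_ge0 ?expR_ge0// ltW.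
have : 0 <= q * expR (- beta * (x - 1)) by rewrite mulr_ge0 ?expR_ge0// ltW.
set a := q * _; set b := 1 + q * _ => a0 b1 a10 b10.
have ib : b^-1 <= 1 by rewrite invf_le1.
have : 1 - (1 + a)^-1 <= a.
  have -> : 1 - (1 + a)^-1 = a / (1 + a) by have := lt0r_neq0 a10 => ?; field.
  by rewrite ler_pdivrMr// ler_peMr// lerDl.
lra.
Qed.

Lemma Psi_ge0 q beta x : 0 < q -> 0 < beta -> 0 <= Psi q beta x.
Proof.
by move=> q0 b0; rewrite /Psi mulr_ge0// addr_ge0// G_ge0// invr_gt0.
Qed.

Lemma PsiN q beta x : 0 < q -> Psi q beta (- x) = Psi q beta x.
Proof. by move=> q0; rewrite /Psi !GN ?invr_gt0// invrK addrC. Qed.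

Lemma Psi_le_expR q beta x : 0 < q -> 0 < beta ->
  Psi q beta x <= (q + q^-1) * expR beta * expR (- beta * x).
Proof.
move=> q0 b0; have qV0 : 0 < q^-1 by rewrite invr_gt0.
have := G_le_expR q beta x q0 b0; have := G_le_expR q^-1 beta x qV0 b0.
have := G_ge0 q beta x q0 b0; have := G_ge0 q^-1 beta x qV0 b0.
rewrite /Psi !mulrDl; lra.
Qed.

Lemma is_derive_logistic_den q beta c x :
  is_derive x 1 (fun y => 1 + q * expR (- beta * (y + c)))
    (- beta * (q * expR (- beta * (x + c)))).
Proof.
have d0 : is_derive x 1 (fun y => - beta * (y + c)) (- beta).
  by apply: is_derive_eq; rewrite /GRing.scale/=; ring.
have d1 : is_derive x 1 (fun y => expR (- beta * (y + c)))
    (expR (- beta * (x + c)) * - beta).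
  exact: (@is_derive1_comp R expR (fun y => - beta * (y + c))).
by apply: is_derive_eq; rewrite /GRing.scale/=; ring.
Qed.

Lemma is_derive_ln_logistic_den q beta c x : 0 < q -> 0 < beta ->
  is_derive x 1 (fun y => ln (1 + q * expR (- beta * (y + c))))
    (beta / 2 * (nu q beta (x + c) - 1)).
Proof.
move=> q0 b0; have E0 := logistic_den_gt0 q beta (x + c) q0.
have := is_derive1_ln E0 => dln.
have d1 := is_derive_logistic_den q beta c x.
have := @is_derive1_comp R (@ln R) (fun y => 1 + q * expR (- beta * (y + c)))
  _ _ _ dln d1.
move/is_derive_eq; apply.
by rewrite nuE//; field; rewrite lt0r_neq0.
Qed.

(* The logarithms arise because [nu q beta - 1] is, up to the factor
   [2 / beta], the derivative of [ln (1 + q * expR (- beta * x))]. *)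
Definition Psi_primitive q beta x : R :=
  let L s c := ln (1 + s * expR (- beta * (x + c))) in
  (4 * beta)^-1 * (L q 1 - L q (- 1) + (L q^-1 1 - L q^-1 (- 1))).

Lemma is_derive_Psi_primitive q beta x : 0 < q -> 0 < beta ->
  is_derive x 1 (Psi_primitive q beta) (Psi q beta x).
Proof.
move=> q0 b0; have qV0 : 0 < q^-1 by rewrite invr_gt0.
have d1 := is_derive_ln_logistic_den q beta 1 x q0 b0.
have d2 := is_derive_ln_logistic_den q beta (-1) x q0 b0.
have d3 := is_derive_ln_logistic_den q^-1 beta 1 x qV0 b0.
have d4 := is_derive_ln_logistic_den q^-1 beta (-1) x qV0 b0.
rewrite /Psi_primitive.
apply: is_derive_eq.
by rewrite /Psi /G /GRing.scale/=; field; rewrite lt0r_neq0.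
Qed.

(** Pulling [q * expR (- beta)] and [q^-1 * expR (- beta)] out of two of the logarithms leaves
    remainders that cancel the other two; only [- 2 * beta] survives. *)
Lemma Psi_primitive0 q beta : 0 < q -> 0 < beta ->
  Psi_primitive q beta 0 = - 2^-1.
Proof.
move=> q0 b0; rewrite /Psi_primitive !add0r !mulrN !mulr1 opprK.
have qV0 : 0 < q^-1 by rewrite invr_gt0.
have eb := expR_gt0 beta.
have h1 : 1 + q * expR (- beta) = q * expR (- beta) * (1 + q^-1 * expR beta).
  by rewrite expRN; field; rewrite !lt0r_neq0.
have h2 : 1 + q^-1 * expR (- beta) = q^-1 * expR (- beta) * (1 + q * expR beta).
  by rewrite expRN; field; rewrite !lt0r_neq0.
have p1 : 1 + q^-1 * expR beta \is Num.pos by rewrite posrE addr_gt0 ?mulr_gt0.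
have p2 : 1 + q * expR beta \is Num.pos by rewrite posrE addr_gt0 ?mulr_gt0.
rewrite h1 h2 !lnM ?posrE ?mulr_gt0 ?expR_gt0// expRK lnV//.
by field; rewrite lt0r_neq0.
Qed.

Lemma cvg_ln_logistic_den q beta c : 0 < q -> 0 < beta ->
  ln (1 + q * expR (- beta * (x + c))) @[x --> +oo] --> (0 : R).
Proof.
move=> q0 b0.
have h : 1 + q * expR (- beta * (x + c)) @[x --> +oo] --> (1 : R).
  rewrite -[X in _ --> X]addr0; apply: cvgD; first exact: cvg_cst.
  rewrite -(mulr0 q); apply: cvgMl_tmp.
  under eq_fun do rewrite mulNr.
  apply: (@cvg_comp _ _ _ (fun x => beta * (x + c)) (fun z => expR (- z)) _
    (pinfty_nbhs R)); last exact: cvgr_expR.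
  apply: (@cvg_comp _ _ _ (fun x => x + c) (fun z => beta * z) _
    (pinfty_nbhs R)); last exact: gt0_cvgMry.
  exact: cvg_addrr.
rewrite -[X in _ --> X]ln1.
exact: (cvg_comp _ _ h (continuous_ln ltr01)).
Qed.

Lemma cvg_Psi_primitive q beta : 0 < q -> 0 < beta ->
  Psi_primitive q beta x @[x --> +oo] --> (0 : R).
Proof.
move=> q0 b0; have qV0 : 0 < q^-1 by rewrite invr_gt0.
rewrite -[X in _ --> X](mulr0 (4 * beta)^-1); apply: cvgMl_tmp.
rewrite -[X in _ --> X]addr0 -[X in _ --> X + X]subr0.
by apply: cvgD; apply: cvgB; exact: cvg_ln_logistic_den.
Qed.

Lemma nu_continuous q beta c : 0 < q -> continuous (fun x => nu q beta (x + c)).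
Proof.
move=> q0 x; under eq_fun do rewrite nuE//.
apply: cvgB; last exact: cvg_cst.
apply: cvgMl_tmp; apply: cvgV; first by rewrite lt0r_neq0// logistic_den_gt0.
have [/derivable1_diffP d _] := is_derive_logistic_den q beta c x.
exact: (differentiable_continuous d).
Qed.

Lemma Psi_continuous q beta : 0 < q -> continuous (Psi q beta).
Proof.
move=> q0 x; have qV0 : 0 < q^-1 by rewrite invr_gt0.
by apply: cvgMl_tmp; apply: cvgD; apply: cvgMl_tmp; apply: cvgB; exact: nu_continuous.
Qed.

End kernel.

(** * Integrals of the kernel and reflection of the variable *)

Section integrals.
Context {R : realType}.
Notation mu := (@lebesgue_measure R).

(** Evenness gives twice the half-line integral, over which the primitive rises from [- 2^-1] at 0
    to the limit 0. *)
Lemma Rintegral_Psi (q beta : R) : 0 < q -> 0 < beta ->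
  \int[mu]_x Psi q beta x = 1.
Proof.
move=> q0 b0; rewrite /Rintegral ge0_symfun_integralT; first last.
- by move=> x /=; rewrite PsiN.
- exact: Psi_continuous.
- by move=> x; exact: Psi_ge0.
rewrite -set_itvcy (@ge0_continuous_FTC2y _ _ (Psi_primitive q beta) 0 0).
- by rewrite Psi_primitive0// sub0e EFinN oppeK -EFinM/= divff.
- by move=> x _; exact: Psi_ge0.
- by apply: continuous_subspaceT; exact: Psi_continuous.
- exact: cvg_Psi_primitive.
- by move=> x _; have [] := is_derive_Psi_primitive q beta x q0 b0.
- apply: cvg_at_right_filter; apply/differentiable_continuous/derivable1_diffP.
  by have [] := is_derive_Psi_primitive q beta 0 q0 b0.
- move=> x _; rewrite derive1E.
  by have [_ ->] := is_derive_Psi_primitive q beta x q0 b0.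
Qed.

(** The weight dominates every function of linear growth up to a constant, so [C_B] and [C_U] are
    served at once. Half of the decay rate of [Psi] absorbs the weight; the other half is compared
    with an exponential density. *)
Lemma integrable_Psi_moment (q beta : R) : 0 < q -> 0 < beta ->
  mu.-integrable setT (EFin \o (fun x => (1 + `|x|) * Psi q beta x)).
Proof.
move=> q0 b0.
have nn x : 0 <= (1 + `|x|) * Psi q beta x by rewrite mulr_ge0 ?addr_ge0// Psi_ge0.
have cont : continuous (fun x => (1 + `|x|) * Psi q beta x).
  move=> x; apply: cvgM; last exact: Psi_continuous.
  by apply: cvgD; [exact: cvg_cst|exact: norm_continuous].
apply/integrableP; split.
  by apply/measurable_EFinP; exact: continuous_measurable_fun.
under eq_integral do rewrite /= ger0_norm//.
rewrite ge0_symfun_integralT//; last by move=> x /=; rewrite normrN PsiN.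
rewrite -set_itvcy; pose b := beta / 2; have bp : 0 < b by rewrite divr_gt0.
(* The first factor comes from [1 + x <= (1 + b^-1) * expR (b * x)], the second from the bound on
   [Psi]; dividing by [b] undoes the normalisation of the exponential density. *)
pose K := (1 + b^-1) * ((q + q^-1) * expR beta) / b.
have K0 : 0 <= K.
  by rewrite !mulr_ge0 ?addr_ge0 ?invr_ge0 ?expR_ge0// ltW.
apply: (@le_lt_trans _ _ (2%:E * (K%:E * \int[mu]_x (exponential_pdf b x)%:E))%E); last first.
  by rewrite integral_exponential_pdf// mule1 -EFinM ltry.
rewrite lee_pmul2l// -ge0_integralZl//; first last.
- by move=> x _; rewrite lee_fin exponential_pdf_ge0// ltW.
- by apply/measurable_EFinP; exact: measurable_exponential_pdf.
(* Extension by zero moves the comparison to the whole line, where the exponential density has mass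
   1. *)
rewrite [leLHS]integral_mkcond; apply: ge0_le_integral => //.
- by move=> x _; rewrite patchE; case: ifPn => // _; rewrite lee_fin.
- apply/(measurable_restrictT _ _).1 => //.
  by apply/measurable_EFinP/measurable_funTS; exact: continuous_measurable_fun.
- apply: emeasurable_funM => //.
  by apply/measurable_EFinP; exact: measurable_exponential_pdf.
move=> x _; rewrite patchE; case: ifPn => [|_]; last first.
  by rewrite mule_ge0 ?lee_fin// exponential_pdf_ge0// ltW.
rewrite inE/= in_itv/= andbT => x0; rewrite -EFinM lee_fin exponential_pdfE//.
rewrite ger0_norm//.
have x_le : 1 + x <= (1 + b^-1) * expR (b * x).
  apply: (@le_trans _ _ ((1 + b^-1) * (1 + b * x))); last first.
    by rewrite ler_pM2l ?expR_ge1Dx// addr_gt0// invr_gt0.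
  have -> : (1 + b^-1) * (1 + b * x) = 1 + x + (b * x + b^-1).
    by field; rewrite lt0r_neq0.
  by rewrite lerDl addr_ge0 ?mulr_ge0 ?invr_ge0// ltW.
apply: (le_trans (ler_pM _ _ x_le (Psi_le_expR q beta x q0 b0))).
- by rewrite addr_ge0.
- exact: Psi_ge0.
have -> : expR (- beta * x) = expR (- b * x) * expR (- b * x).
  by rewrite -expRD /b; congr expR; field.
rewrite mulNr expRN /K le_eqVlt; apply/orP; left; apply/eqP.
by field; rewrite !lt0r_neq0// expR_gt0.
Qed.

(** By uniqueness of Lebesgue measure it suffices to check half-open intervals, and the preimage of
    []a, b]] is [[c - b, c - a[], of the same length. *)
Lemma lebesgue_measure_subr (c : R) (A : set R) : measurable A ->
  pushforward mu (fun u => c - u : measurableTypeR R) A = mu A.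
Proof.
move=> mA; apply/esym/lebesgue_measure_unique => //=; first exact: measurable_funB.
move=> _ _ [[a b]] _ <-.
rewrite /pushforward/=.
have -> : (fun u => c - u) @^-1` [set` `]a, b]] = [set` `[c - b, c - a[].
  apply/seteqP; split => x /=; rewrite !in_itv/= => /andP[? ?]; apply/andP; split; lra.
rewrite !lebesgue_measure_itv/= !lte_fin ltrD2l ltrN2.
by case: ifPn => // _; rewrite -!EFinD; congr EFin; lra.
Qed.

Lemma Rintegral_subr (c : R) (f : R -> R) : measurable_fun setT f ->
  mu.-integrable setT (EFin \o (fun u => f (c - u))) ->
  \int[mu]_v f v = \int[mu]_u f (c - u).
Proof.
move=> mf fi; rewrite /Rintegral; congr fine.
pose phi (u : R) : measurableTypeR R := c - u.
have mphi : measurable_fun setT phi by exact: measurable_funB.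
transitivity (\int[pushforward mu phi]_v (f v)%:E)%E.
  by apply: eq_measure_integral => A mA _; exact/esym/lebesgue_measure_subr.
by rewrite integral_pushforward//; exact/measurable_EFinP.
Qed.

End integrals.

(** * Linear growth of [f] and integrability against the kernel *)

Section growth.
Context {R : realType}.
Notation mu := (@lebesgue_measure R).

Definition linear_growth (f : R -> R) :=
  exists2 A : R, 0 <= A & forall x, `|f x| <= A * (1 + `|x|).

Lemma C_UP (f : R -> R) : C_U f <->
  forall e, 0 < e -> exists2 d, 0 < d &
    forall x y, `|x - y| < d -> `|f x - f y| < e.
Proof.
split=> [/unif_continuousP uf e /uf[d d0 ud]|uf].
  by exists d => // x y; exact: (ud (x, y)).
by apply/unif_continuousP => e /uf[d d0 ud]; exists d => // -[x y]; exact: ud.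
Qed.

Lemma C_U_continuous (f : R -> R) : C_U f -> continuous f.
Proof.
move=> /C_UP uf x; apply/cvgrPdist_lt => e /uf[d d0 ud]; near=> y.
apply: ud; near: y; exact: cvgr_dist_lt.
Unshelve. all: by end_near. Qed.

(** The segment from 0 to [x] is cut into [k] equal steps shorter than [d]; [f] changes by less than
    1 on each, and [k] is at most [|x| / d + 1]. *)
Lemma C_U_linear_growth (f : R -> R) : C_U f -> linear_growth f.
Proof.
move=> /C_UP /(_ _ ltr01)[d d0 ud].
exists (`|f 0| + 1 + d^-1) => [|x]; first by rewrite !addr_ge0// invr_ge0 ltW.
pose k := (Num.truncn (`|x| / d)).+1.
have k0 : 0 < k%:R :> R by rewrite ltr0n.
have xk : `|x| / d < k%:R by exact: truncnS_gt.
have kx : k%:R <= `|x| / d + 1.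
  by rewrite -natr1 lerD2r truncn_le// divr_ge0// ltW.
have : `|f x - f 0| <= k%:R.
  have -> : f x - f 0 =
      \sum_(0 <= i < k) (f (x * (i.+1%:R / k%:R)) - f (x * (i%:R / k%:R))).
    rewrite (telescope_sumr (fun i => f (x * (i%:R / k%:R))))//.
    by rewrite mul0r mulr0 divff ?mulr1// lt0r_neq0.
  apply: (le_trans (ler_norm_sum _ _ _)).
  rewrite big_mkord -[leRHS](mulr_natl 1) mulr1 -[in leRHS](card_ord k) -sum1_card.
  rewrite natr_sum ler_sum// => i _; apply/ltW/ud.
  rewrite -mulrBr -mulrBl -natrB// subSnn mul1r normrM normfV (gtr0_norm k0).
  by rewrite ltr_pdivrMr// mulrC -ltr_pdivrMr.
have := ler_normD (f x - f 0) (f 0); rewrite subrK.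
have : 0 <= `|f 0| * `|x| by rewrite mulr_ge0.
have : 0 <= d^-1 by rewrite invr_ge0 ltW.
have := normr_ge0 x.
rewrite !mulrDl !mulrDr; move: kx; rewrite mulrC; lra.
Qed.

Lemma C_B_linear_growth (f : R -> R) : C_B f -> linear_growth f.
Proof.
move=> [_] /pinfty_ex_gt0[M M0 fM]; exists M; first exact: ltW.
by move=> x; rewrite (le_trans (fM x _))// ler_peMr ?lerDl// ltW.
Qed.

Lemma integrable_translate_Psi (q beta c : R) (f : R -> R) : 0 < q -> 0 < beta ->
  continuous f -> linear_growth f ->
  mu.-integrable setT (EFin \o (fun u => f (c - u) * Psi q beta u)).
Proof.
move=> q0 b0 cf [A A0 fA].
(* The constant comes from [1 + |c - u| <= (1 + |c|) * (1 + |u|)]. *)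
have gi := integrableZl measurableT (A * (1 + `|c|)) (integrable_Psi_moment _ _ q0 b0).
apply: (le_integrable measurableT _ _ gi).
- apply/measurable_EFinP; apply: continuous_measurable_fun => x.
  apply: cvgM; last exact: Psi_continuous.
  apply: continuous_comp; last exact: cf.
  by apply: cvgB; [exact: cvg_cst|exact: cvg_id].
- move=> u _; rewrite /= lee_fin normrM (ger0_norm (Psi_ge0 _ _ _ q0 b0)).
  rewrite [leRHS]ger0_norm; last first.
    by rewrite mulr_ge0 ?(mulr_ge0 A0) ?addr_ge0// mulr_ge0 ?addr_ge0// Psi_ge0.
  rewrite [leRHS]mulrA ler_wpM2r ?Psi_ge0// (le_trans (fA _))// -mulrA ler_wpM2l//.
  have := ler_normB c u; have : 0 <= `|c| * `|u| by rewrite mulr_ge0.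
  lra.
Qed.

End growth.

(** * The quadrature means and the increments of the operator *)

Section quadrature.
Context {R : realType}.
Notation mu := (@lebesgue_measure R).
Variables (q beta : R) (n r : nat) (w : 'I_r -> R).
Hypotheses (q0 : 0 < q) (b0 : 0 < beta) (n0 : (0 < n)%N) (r0 : (0 < r)%N).
Hypotheses (w_ge0 : forall i, 0 <= w i) (w_sum : \sum_(i < r) w i = 1).

Lemma norm_weighted_mean_le (g : 'I_r -> R) (M : R) : (forall i, `|g i| <= M) ->
  `|\sum_(i < r) w i * g i| <= M.
Proof.
move=> gM; apply: (le_trans (ler_norm_sum _ _ _)).
rewrite -[leRHS]mul1r -w_sum mulr_suml ler_sum// => i _.
by rewrite normrM ger0_norm// ler_wpM2l.
Qed.

Definition quadrature (f : R -> R) (v : R) : R :=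
  \sum_(i < r) w i * f (v / n%:R + i.+1%:R / (n * r)%:R).

Lemma quadrature_continuous (f : R -> R) : continuous f -> continuous (quadrature f).
Proof.
move=> cf x; apply: cvg_big; first exact: add_continuous.
move=> i _; apply: cvgMl_tmp.
apply: (@continuous_comp _ _ _
  (fun v : R => v / n%:R + i.+1%:R / (n * r)%:R) f); last exact: cf.
by apply: cvgD; [apply: cvgMr_tmp; exact: cvg_id|exact: cvg_cst].
Qed.

Lemma quadrature_linear_growth (f : R -> R) : linear_growth f -> linear_growth (quadrature f).
Proof.
(* Each node lies within 1 of [x / n], and [|x / n| <= |x|], so 1 plus its absolute value is at most
   [2 + |x| <= 2 * (1 + |x|)]. *)
move=> [A A0 fA]; exists (A * 2); first by rewrite mulr_ge0.
move=> x; apply: norm_weighted_mean_le => i; rewrite (le_trans (fA _))// -mulrA ler_wpM2l//.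
have n1 : 1 <= n%:R :> R by rewrite ler1n.
have hx : `|x / n%:R| <= `|x|.
  by rewrite normrM normfV (ger0_norm (le_trans ler01 n1)) ler_piMr// invf_le1// ltr0n.
have hi : `|i.+1%:R / (n * r)%:R : R| <= 1.
  rewrite ger0_norm ?divr_ge0// ler_pdivrMr ?ltr0n ?muln_gt0 ?n0// mul1r ler_nat.
  by rewrite (leq_trans (ltn_ord i))// leq_pmull.
have := ler_normD (x / n%:R) (i.+1%:R / (n * r)%:R).
have := normr_ge0 x.
lra.
Qed.

(** The offsets of the nodes cancel in the difference, leaving the increment [(x - y) / n] for every
    index. *)
Lemma dist_quadrature_le (f : R -> R) (M x y : R) :
  (forall a b, `|a - b| <= `|x - y| / n%:R -> `|f a - f b| <= M) ->
  `|quadrature f x - quadrature f y| <= M.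
Proof.
move=> fM; rewrite /quadrature -sumrB.
under eq_bigr do rewrite -mulrBr.
apply: norm_weighted_mean_le => i; apply: fM.
rewrite opprD addrACA subrr addr0 -mulrBl normrM normfV.
by rewrite [ `|n%:R|]ger0_norm.
Qed.

(** This moves [x] from the kernel into [f], so that values at two points are averaged against the
    same density. *)
Lemma Bbar_convolution (f : R -> R) (x : R) : continuous f -> linear_growth f ->
  Bbar q beta n w f x =
  \int[mu]_u (quadrature f (n%:R * x - u) * Psi q beta u).
Proof.
move=> cf gf.
have cS := quadrature_continuous _ cf; have gS := quadrature_linear_growth _ gf.
rewrite /Bbar (Rintegral_subr (n%:R * x)).
- by apply: eq_Rintegral => u _; rewrite subKr.
- apply: continuous_measurable_fun => v; apply: cvgM; first exact: cS.
  apply: (@continuous_comp _ _ _ (fun v => n%:R * x - v) (Psi q beta)); last exact: Psi_continuous.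
  by apply: cvgB; [exact: cvg_cst|exact: cvg_id].
- have := integrable_translate_Psi _ _ (n%:R * x) _ q0 b0 cS gS.
  by apply: eq_integrable => // u _; rewrite /= subKr.
Qed.

(** Both claims of the theorem are read off from this estimate, with [M] a finite value of [omega]
    or a fraction of epsilon. *)
Lemma dist_Bbar_le (f : R -> R) (M x y : R) : continuous f -> linear_growth f ->
  (forall a b, `|a - b| <= `|x - y| -> `|f a - f b| <= M) ->
  `|Bbar q beta n w f x - Bbar q beta n w f y| <= M.
Proof.
move=> cf gf fM; rewrite !Bbar_convolution//.
have cS := quadrature_continuous _ cf; have gS := quadrature_linear_growth _ gf.
have ix := integrable_translate_Psi _ _ (n%:R * x) _ q0 b0 cS gS.
have iy := integrable_translate_Psi _ _ (n%:R * y) _ q0 b0 cS gS.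
(* This is the case of the constant function 1. *)
have iPsi : mu.-integrable setT (EFin \o Psi q beta).
  have c1 : continuous (cst 1 : R -> R) by move=> ?; exact: cvg_cst.
  have g1 : linear_growth (cst 1 : R -> R).
    by exists 1 => // u; rewrite normr1 mul1r lerDl.
  have := integrable_translate_Psi _ _ 0 _ q0 b0 c1 g1.
  by apply: eq_integrable => // u _; rewrite /= mul1r.
rewrite -RintegralB//.
have iD : mu.-integrable setT (EFin \o (fun u =>
    quadrature f (n%:R * x - u) * Psi q beta u -
    quadrature f (n%:R * y - u) * Psi q beta u)).
  by have := integrableB measurableT ix iy; exact: eq_integrable.
rewrite (le_trans (le_normr_Rintegral _ iD))//.
have -> : M = \int[mu]_u (M * Psi q beta u).
  by rewrite RintegralZl// Rintegral_Psi// mulr1.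
apply: le_Rintegral => //.
- exact: (integrable_norm iD).
- by have := integrableZl measurableT M iPsi; exact: eq_integrable.
move=> u _; rewrite -mulrBl normrM (ger0_norm (Psi_ge0 _ _ _ q0 b0)).
rewrite ler_wpM2r ?Psi_ge0//; apply: dist_quadrature_le => a b.
(* The dilation by [n] in the kernel argument cancels the division by [n] in the nodes. *)
rewrite (_ : n%:R * x - u - _ = n%:R * (x - y)); last by ring.
rewrite normrM ger0_norm// mulrAC divff ?mul1r; first exact: fM.
by rewrite pnatr_eq0 -lt0n.
Qed.

End quadrature.

(** * Passage to the modulus of continuity *)

Lemma le_omega {R : realType} (f : R -> R) (theta x y : R) :
  `|x - y| <= theta -> (`|f x - f y|%:E <= omega f theta)%E.
Proof. by move=> xy; apply: ereal_sup_ubound; exists (x, y). Qed.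

Lemma omega_le {R : realType} (f : R -> R) (theta : R) (M : \bar R) :
  (forall x y, `|x - y| <= theta -> (`|f x - f y|%:E <= M)%E) ->
  (omega f theta <= M)%E.
Proof. by move=> fM; apply: ge_ereal_sup => _ [[x y] /= xy <-]; exact: fM. Qed.

Theorem theorem7 (R : realType) (q beta : R) (hq : 0 < q) (hbeta : 0 < beta)
    (n : nat) (hn : (0 < n)%N) (r : nat) (hr : (0 < r)%N) (w : 'I_r -> R)
    (w_ge0 : forall i, 0 <= w i) (w_sum : \sum_(i < r) w i = 1) :
  (forall f : R -> R, (C_B `|` C_U) f ->
     forall theta : R, 0 < theta ->
       (omega (Bbar q beta n w f) theta <= omega f theta)%E) /\
  (forall f : R -> R, C_U f -> C_U (Bbar q beta n w f)).
Proof.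
split=> [f fBU theta theta0|f fU].
  have cf : continuous f by case: fBU => [[]|/C_U_continuous].
  have gf : linear_growth f.
    by case: fBU => [/C_B_linear_growth|/C_U_linear_growth].
  (* The pair [(0, 0)] shows that [omega f theta] is nonnegative, which excludes [-oo]; at [+oo] the
     inequality is trivial. *)
  have := le_omega f theta 0 0; rewrite !subrr normr0 => /(_ (ltW theta0)).
  case E : (omega f theta) => [M| |] // _; last by rewrite leey.
  apply: omega_le => x y xy; rewrite lee_fin; apply: dist_Bbar_le => // a b ab.
  by rewrite -lee_fin -E le_omega// (le_trans ab).
(* Averaging yields only a non-strict bound, so [e / 2] is used to stay strictly below [e]; the [d]
   of [f] then serves unchanged. *)
apply/C_UP => e e0; have /C_UP/(_ (e / 2))[|d d0 fd] := fU.
  by rewrite divr_gt0.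
exists d => // x y xy; apply: (@le_lt_trans _ _ (e / 2)); last first.
  by rewrite gtr_pMr// invf_lt1// ltr1n.
apply: dist_Bbar_le => //.
- exact: C_U_continuous.
- exact: C_U_linear_growth.
- by move=> a b ab; apply/ltW/fd/(le_lt_trans ab).
Qed.
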